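(* For every finite forest $F$, $$\mathcal A(F)\mathbf 1=U_F.$$ In particular, for every finite tree $T$, $\mathcal A(T)\mathbf 1=U_T$.
   Context: For a finite simple graph $G$ with vertex set $V$, adjacency matrix $A$ and diagonal degree matrix $D$, $\mathcal A(G)=\langle I,A,D\rangle\subseteq M_V(\mathbb R)$ is the real algebra generated by $I,A,D$; $\mathbf 1\in\mathbb R^V$ is the all-ones vector; $\mathcal A(G)\mathbf 1=\{X\mathbf 1:X\in\mathcal A(G)\}$. The automorphism-orbit module is $U_G=\operatorname{span}\{\mathbf 1_O : O \text{ an orbit of } \operatorname{Aut}(G) \text{ on } V\}\subseteq\mathbb R^V$, where $\mathbf 1_O$ is the indicator vector of $O$. A forest is an acyclic graph (not necessarily connected); a tree is a connected forest. *)

(* Defs.v *)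
From HB Require Import structures.
From mathcomp Require Import all_boot all_order all_fingroup all_algebra.
From mathcomp Require Import all_classical all_reals.

Set Implicit Arguments.
Unset Strict Implicit.
Unset Printing Implicit Defensive.

Import GRing.Theory.
Local Open Scope ring_scope.

Section Graphs.
Variables (V : finType) (e : rel V).

Definition simple_graph : Prop := symmetric e /\ irreflexive e.

(* [ucycle e c]: c is duplicate-free and consecutive vertices, cyclically, are
   adjacent.  Every edge xy gives the closed walk [:: x; y], which is not a
   cycle of a simple graph, whence the length condition. *)
Definition acyclic : Prop := forall c : seq V, ucycle e c -> (size c <= 2)%N.

Definition connected : Prop := forall x y : V, connect e x y.

Definition forest : Prop := simple_graph /\ acyclic.

Definition tree : Prop := forest /\ connected.

Definition degree (x : V) : nat := #|[set y | e x y]|.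

Definition graph_aut : {set {perm V}} :=
  [set s : {perm V} | [forall x, forall y, e (s x) (s y) == e x y]].

Lemma graph_aut_group_set : group_set graph_aut.
Proof.
apply/group_setP; split.
  by rewrite inE; apply/forallP => x; apply/forallP => y; rewrite !perm1.
move=> s t; rewrite !inE => /forallP Hs /forallP Ht.
apply/forallP => x; apply/forallP => y; rewrite !permM.
by rewrite (eqP (forallP (Ht _) _)) (eqP (forallP (Hs _) _)).
Qed.

Canonical graph_aut_group := Group graph_aut_group_set.

Definition aut_orbits : {set {set V}} :=
  [set orbit 'P%act graph_aut x | x : V].

End Graphs.

(* Unital subalgebras.  These are the clauses of [GRing.subalg_closed], which
   does not apply as is: 'M[R]_n is an [lalgType] only for n of the form m.+1,
   and here n = #|V|. *)
Definition matrix_subalgebra (R : realType) (n : nat) (S : set 'M[R]_n) : Prop :=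
  [/\ S 1%:M,
      forall (a : R) (X Y : 'M[R]_n), S X -> S Y -> S (a *: X + Y)
    & forall X Y : 'M[R]_n, S X -> S Y -> S (X *m Y)].

Definition generated_algebra (R : realType) (n : nat) (G : set 'M[R]_n) :
  set 'M[R]_n := smallest (@matrix_subalgebra R n) G.

(* R^V and M_V(R) are 'cV[R]_#|V| and 'M[R]_#|V|, the index i : 'I_#|V|
   standing for the vertex [enum_val i]. *)
Section GraphAlgebra.
Variables (R : realType) (V : finType) (e : rel V).

Definition adjacency_mx : 'M[R]_#|V| :=
  \matrix_(i, j) (e (enum_val i) (enum_val j))%:R.

Definition degree_mx : 'M[R]_#|V| :=
  diag_mx (\row_i (degree e (enum_val i))%:R).

Definition graph_algebra : set 'M[R]_#|V| :=
  generated_algebra [set 1%:M; adjacency_mx; degree_mx]%classic.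

Definition ones : 'cV[R]_#|V| := const_mx 1.

Definition graph_algebra_ones : set 'cV[R]_#|V| :=
  [set X *m ones | X in graph_algebra]%classic.

Definition indicator (B : {set V}) : 'cV[R]_#|V| :=
  \col_i (enum_val i \in B)%:R.

Definition orbit_module : {vspace 'cV[R]_#|V|} :=
  <<[seq indicator B | B in aut_orbits e]>>%VS.

End GraphAlgebra.

Arguments adjacency_mx R {V} e.
Arguments degree_mx R {V} e.
Arguments graph_algebra R {V} e.
Arguments ones R V : clear implicits.
Arguments graph_algebra_ones R {V} e.
Arguments orbit_module R {V} e.

(* Main.v *)
Require Import Defs.
From mathcomp Require Import all_boot all_order all_fingroup all_algebra.
From mathcomp Require Import all_classical all_reals.
From mathcomp Require Import fintype finset.

Set Implicit Arguments.
Unset Strict Implicit.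
Unset Printing Implicit Defensive.

(** Why the theorem holds.  Let M be the graph algebra of the forest F.

    Vectors in M 1 are constant on orbits because every matrix in M commutes
    with the permutation matrices of automorphisms ([graph_algebra_aut]).  The
    content is the converse: the indicator of each orbit lies in M 1.

    Call two vertices M-equivalent when no diagonal matrix of M tells them
    apart.  By Lagrange interpolation M contains the diagonal matrix of every
    function that is constant on M-equivalence classes ([alg_diag_invariant]);
    in particular multiplication by the indicator of a union of classes
    preserves M 1.  Conversely, a diagonal matrix in M gives a function constant
    on classes.  The degree matrix shows this for degrees.  Moreover, if T and K
    are unions of classes such that no two vertices of T share a neighbour in K,
    then P_T A P_K A P_T is diagonal and counts the neighbours in K, where P_T
    and P_K are the coordinate projections.  Hence this count is constant on the
    classes in T ([diag_equiv_card_nbrs]).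

    Now strip leaves.  For a union of classes S, let the core of S consist of
    the vertices with at least two neighbours in S; in a forest it is smaller
    than S unless S is empty ([core_proper]).  The vertices of S outside the
    core, its fringe, have at most one neighbour in S, so the counting principle
    applies to every union of classes K in the fringe.  Subtracting such counts
    keeps the degrees inside the core constant on classes ([core_regular]), so
    the stripping can be repeated, starting from S = V.  Consider the bijections
    of S that preserve adjacency and M-equivalence.
    - A core vertex has the same orbit for S as for the core, because a
      bijection of the core extends to the fringe: M-equivalent core vertices
      carry equally many leaves of each class ([extend_aut]).
    - The orbit of a fringe vertex x with neighbour p in the core consists of
      the vertices M-equivalent to x that have a neighbour in the orbit of p
      ([local_orbit_leaf]).  Its indicator is obtained from that of the orbit of
      p by applying A and then restricting to the class of x; no vertex is
      counted twice, since a fringe vertex has only one neighbour in S.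
    - For any other fringe vertex, isolated in S or in a component with two
      vertices, the orbit is its whole class ([local_orbit_orphan]).
    Induction on S puts the indicators of all these orbits in M 1
    ([local_orbit_definable]).  For S = V the bijections are exactly the
    automorphisms of F, because automorphisms preserve M-equivalence. *)

(** * Transport between sets of equal size *)

Section Transport.
Variable V : finType.

Definition transport (A B : {set V}) (a : V) : V :=
  nth a (enum B) (index a (enum A)).

Lemma transport_in (A B : {set V}) a :
  #|A| = #|B| -> a \in A -> transport A B a \in B.
Proof.
move=> AB aA; rewrite -mem_enum mem_nth // -cardE -AB cardE index_mem.
by rewrite mem_enum.
Qed.

Lemma transport_inj (A B : {set V}) :
  #|A| = #|B| -> {in A &, injective (transport A B)}.
Proof.
move=> AB a b aA bA; rewrite /transport.
have lt c : c \in A -> index c (enum A) < size (enum B).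
  by move=> cA; rewrite -cardE -AB cardE index_mem mem_enum.
rewrite (set_nth_default b) ?lt // => /eqP.
rewrite nth_uniq ?enum_uniq ?lt // => /eqP E.
by rewrite -[a](nth_index a (s := enum A)) ?mem_enum // E nth_index // mem_enum.
Qed.

End Transport.

(** * Cores of vertex sets in a forest *)

Section Neighbours.
Variables (V : finType) (e : rel V).
Hypotheses (e_sym : symmetric e) (e_irr : irreflexive e) (e_acyc : acyclic e).

Definition nbrs (B : {set V}) (x : V) : {set V} := [set y in B | e x y].

Definition core (S : {set V}) : {set V} := [set x in S | 1 < #|nbrs S x|].

Lemma core_sub (S : {set V}) : core S \subset S.
Proof. by apply/subsetP => x; rewrite inE => /andP[]. Qed.

Lemma fringe_nbr_uniq (S : {set V}) (a u v : V) :
  a \in S :\: core S -> u \in S -> v \in S -> e a u -> e a v -> u = v.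
Proof.
rewrite !inE => /andP[aC aS] uS vS eu ev.
move: aC; rewrite aS /= -leqNgt => /card_le1_eqP; apply.
  by rewrite !inE vS.
by rewrite !inE uS.
Qed.

(** Without a vertex to strip, a path can always be prolonged: its end has a
    neighbour other than the preceding vertex, and that neighbour cannot lie on
    the path, for lack of cycles. *)
Lemma long_path (S : {set V}) (x0 : V) (n : nat) :
  x0 \in S -> core S = S ->
  exists x p, [/\ path e x p, uniq (x :: p), all (mem S) (x :: p) & size p = n].
Proof.
move=> x0S coreS; elim: n => [|n [x [p [pth unq pS szp]]]].
  by exists x0, [::]; rewrite /= x0S.
have xS : x \in S by case/andP: pS.
have : x \in core S by rewrite coreS.
rewrite inE xS /= => /card_gt1P[y1 [y2 [y1N y2N y12]]].
have [y [yS exy yp]] : exists y, [/\ y \in S, e x y & y != head x p].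
  move: y1N y2N; rewrite !inE => /andP[y1S e1] /andP[y2S e2].
  have [E|] := eqVneq y1 (head x p); last by exists y1.
  by exists y2; rewrite -E eq_sym.
have yx : y != x by apply: contraL exy => /eqP->; rewrite e_irr.
have [yinp|ynp] := boolP (y \in p); last first.
  exists y, (x :: p); split => //=; last by rewrite szp.
  - by rewrite e_sym exy.
  - by move: unq => /= ->; rewrite inE negb_or yx ynp.
  - by move: pS => /= ->; rewrite yS.
(* the detour from x back to y closes up into a cycle *)
case/splitPr: yinp pth unq yp pS szp => p1 p2 pth unq yp _ _.
have p1N : 0 < size p1 by case: p1 yp {pth unq} => //=; rewrite eqxx.
have cyc : ucycle e (x :: rcons p1 y).
  rewrite /ucycle -cats1 /=; apply/andP; split.
    rewrite rcons_cat cat_path /=; move: pth; rewrite cat_path /= => /and3P[-> -> _].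
    by rewrite e_sym exy.
  by move: unq; rewrite -(cat1s y p2) -cat_cons catA cat_uniq => /andP[].
by have := e_acyc cyc; rewrite /= size_rcons; case: (p1) p1N.
Qed.

(** A path on [#|V|.+1] distinct vertices is one too long. *)
Lemma core_proper (S : {set V}) (x : V) : x \in S -> core S \proper S.
Proof.
move=> xS; rewrite properEneq core_sub andbT; apply/eqP => coreS.
have [y [p [_ unq _ szp]]] := long_path #|V| xS coreS.
by have := max_card (mem (y :: p)); rewrite (card_uniqP unq) /= szp ltnn.
Qed.

(** * Vertex equivalences compatible with counting neighbours *)

Variable r : rel V.
Hypothesis r_eqv : equivalence_rel r.

Lemma rxx x : r x x. Proof. by have [] := r_eqv x x x. Qed.
Lemma r_left x y : r x y -> r x =1 r y.
Proof. by move=> rxy z; have [_ ->] := r_eqv x y z. Qed.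
Lemma rC x y : r x y = r y x.
Proof. by apply/idP/idP => h; rewrite -(r_left h) rxx. Qed.

Definition stable (B : {set V}) := forall x y, r x y -> x \in B -> y \in B.

Definition rclass (x : V) : {set V} := [set y | r x y].

Lemma stableE (B : {set V}) x y : stable B -> r x y -> (x \in B) = (y \in B).
Proof. by move=> Bst rxy; apply/idP/idP; apply: Bst => //; rewrite rC. Qed.

Lemma rclass_stable x : stable (rclass x).
Proof. by move=> y z ryz; rewrite !inE => rxy; rewrite (r_left rxy). Qed.

Lemma rclass_eq x y : r x y -> rclass x = rclass y.
Proof. by move=> rxy; apply/setP => z; rewrite !inE (r_left rxy). Qed.

Lemma stableD (B C : {set V}) : stable B -> stable C -> stable (B :\: C).
Proof.
by move=> sB sC x y rxy; rewrite !inE (stableE sB rxy) (stableE sC rxy).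
Qed.

Lemma rclass_sub (B : {set V}) x : stable B -> x \in B -> rclass x \subset B.
Proof. by move=> sB xB; apply/subsetP => y; rewrite inE => /sB; apply. Qed.

(** The counting principle supplied by the matrix algebra: the condition on [T]
    and [K] is what makes the associated product of matrices diagonal. *)
Hypothesis card_nbrs_stable : forall T K : {set V}, stable T -> stable K ->
  (forall x y z, x \in T -> y \in T -> z \in K -> e x z -> e y z -> x = y) ->
  forall x y, x \in T -> r x y -> #|nbrs K x| = #|nbrs K y|.

Definition regular (S : {set V}) :=
  stable S /\ forall x y, x \in S -> r x y -> #|nbrs S x| = #|nbrs S y|.

(** * Local automorphisms *)

(** Maps are defined on all of [V], but only their restriction to [S] matters.
    Preserving [r] forces a stable set [S] to be mapped into itself. *)
Definition local_aut (S : {set V}) (s : V -> V) :=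
  [/\ {in S &, injective s}, {in S, forall a, r a (s a)}
    & {in S &, forall a b, e (s a) (s b) = e a b}].

Definition local_orbit (S : {set V}) (x : V) : {set V} :=
  [set y | `[< exists2 s, local_aut S s & s x = y >]].

Lemma local_orbitP S x y :
  reflect (exists2 s, local_aut S s & s x = y) (y \in local_orbit S x).
Proof. by rewrite inE; apply: (iffP idP) => /asboolP. Qed.

Lemma local_aut_comp S s t :
  stable S -> local_aut S s -> local_aut S t -> local_aut S (s \o t).
Proof.
move=> sS [si sr se] [ti tr te].
have tS a : a \in S -> t a \in S by move=> aS; apply: sS (tr _ aS) aS.
split=> [a b aS bS|a aS|a b aS bS] /=.
- by move/si => /(_ (tS a aS) (tS b bS)); apply: ti.
- by rewrite (r_left (tr _ aS)) sr ?tS.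
- by rewrite se ?tS // te.
Qed.

Lemma local_autS (S T : {set V}) s : T \subset S -> local_aut S s -> local_aut T s.
Proof.
move=> /subsetP TS [si sr se]; split.
- by move=> a b /TS aS /TS bS; apply: si.
- by move=> a /TS; apply: sr.
- by move=> a b /TS aS /TS bS; apply: se.
Qed.

Lemma local_aut_twin (S : {set V}) y z :
  y \in S -> z \in S -> r y z -> {in S, forall a, e a y = e a z} ->
  local_aut S (tperm y z).
Proof.
move=> yS zS ryz twin; split.
- by move=> a b _ _; apply: perm_inj.
- by move=> a _; case: tpermP => [->|->|_ _]; rewrite ?rxx // rC.
have fix_nbrs a b : a \in S -> e a (tperm y z b) = e a b.
  by move=> aS; case: tpermP => [->|->|//]; rewrite twin.
move=> a b aS bS; rewrite fix_nbrs; last by case: tpermP.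
by rewrite e_sym fix_nbrs // e_sym.
Qed.

(** * From the core of a set to the set *)

Section Peel.
Variable S : {set V}.
Hypothesis S_reg : regular S.

Let Sst : stable S := proj1 S_reg.

Lemma core_stable : stable (core S).
Proof.
move=> x y rxy; rewrite !inE => /andP[xS d2].
by rewrite (Sst rxy xS) -(proj2 S_reg x y xS rxy).
Qed.

Lemma fringe_stable : stable (S :\: core S).
Proof. exact: stableD Sst core_stable. Qed.

(** Two vertices of [S] with a common neighbour in the fringe coincide, so the
    counting principle applies. *)
Lemma card_fringe_nbrs (K : {set V}) x y :
  stable K -> K \subset S :\: core S -> x \in S -> r x y ->
  #|nbrs K x| = #|nbrs K y|.
Proof.
move=> sK /subsetP KF xS rxy; apply: (card_nbrs_stable Sst sK) => // u v z uS vS zK eu ev.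
by apply: (fringe_nbr_uniq (KF z zK)); rewrite // e_sym.
Qed.

Lemma card_nbrs_core x :
  #|nbrs S x| = #|nbrs (core S) x| + #|nbrs (S :\: core S) x|.
Proof.
rewrite -(cardsID (core S) (nbrs S x)).
congr addn; apply: eq_card => y; rewrite !inE.
  by case: (y \in S); case: (e x y); rewrite ?andbF ?andbT.
by case: (y \in S); rewrite ?andbF ?andbT.
Qed.

(** The degree in the core is the degree in [S] minus the number of neighbours
    in the fringe, and both terms are constant on classes. *)
Lemma core_regular : regular (core S).
Proof.
split; first exact: core_stable.
move=> x y xC rxy; have xS := subsetP (core_sub S) x xC.
have := proj2 S_reg x y xS rxy; rewrite !card_nbrs_core.
by rewrite (card_fringe_nbrs fringe_stable (subxx _) xS rxy) => /addIn.
Qed.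

Definition parent (a : V) : option V := [pick p in core S | e a p].

Lemma parent_Some a p : parent a = Some p -> p \in core S /\ e a p.
Proof. by rewrite /parent; case: pickP => // q /andP[? ?] [<-]. Qed.

Lemma edge_core a q :
  a \in S :\: core S -> q \in core S -> e a q = (parent a == Some q).
Proof.
move=> aF qC; apply/idP/eqP => [eaq|/parent_Some[]//].
rewrite /parent; case: pickP => [p /andP[pC eap]|/(_ q)]; last by rewrite qC eaq.
by congr Some; apply: (fringe_nbr_uniq aF) => //; apply: (subsetP (core_sub S)).
Qed.

Lemma edge_fringe a b p :
  a \in S :\: core S -> b \in S :\: core S -> parent a = Some p -> e a b = false.
Proof.
move=> aF bF /parent_Some[pC eap]; apply/negP => eab.
have bp : b = p.
  apply: (fringe_nbr_uniq aF) => //; first by case/setDP: bF.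
  exact: (subsetP (core_sub S)).
by move: bF; rewrite bp inE pC.
Qed.

Section Extend.
Variable s : V -> V.
Hypothesis s_aut : local_aut (core S) s.

(** A leaf [a] of [p] goes to a leaf of [s p] in the class of [a]; the two sets
    of such leaves have the same size and are matched by their enumerations.
    Isolated vertices and two-vertex components are left in place. *)
Definition extend (a : V) : V :=
  if a \in core S then s a else
  if parent a is Some p
  then transport (nbrs (rclass a) p) (nbrs (rclass a) (s p)) a else a.

Let sC p : p \in core S -> s p \in core S.
Proof. by case: s_aut => _ sr _ pC; apply: core_stable (sr _ pC) pC. Qed.

Lemma card_sibling a p : a \in S :\: core S -> p \in core S ->
  #|nbrs (rclass a) p| = #|nbrs (rclass a) (s p)|.
Proof.
move=> aF pC; apply: card_fringe_nbrs.
- exact: rclass_stable.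
- exact: rclass_sub fringe_stable aF.
- exact: (subsetP (core_sub S)).
- by case: s_aut => _ -> .
Qed.

Lemma extend_leaf a p : a \in S :\: core S -> parent a = Some p ->
  r a (extend a) /\ e (s p) (extend a).
Proof.
move=> aF pa; have [pC eap] := parent_Some pa.
have aC : (a \in core S) = false by case/setDP: aF => _ /negbTE.
have : extend a \in nbrs (rclass a) (s p).
  rewrite /extend aC pa; apply: transport_in; first exact: card_sibling.
  by rewrite !inE rxx e_sym.
by rewrite !inE => /andP[].
Qed.

Lemma extend_r a : a \in S -> r a (extend a).
Proof.
move=> aS; have [aC|aC] := boolP (a \in core S).
  by rewrite /extend aC; case: s_aut => _ ->.
have aF : a \in S :\: core S by rewrite inE aC.
case pa : (parent a) => [p|]; first by case: (extend_leaf aF pa).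
by rewrite /extend (negbTE aC) pa rxx.
Qed.

Lemma extend_core a : a \in core S -> extend a = s a.
Proof. by rewrite /extend => ->. Qed.

Lemma extend_fringe a : a \in S :\: core S -> extend a \in S :\: core S.
Proof.
by move=> aF; apply: fringe_stable (aF); apply: extend_r; case/setDP: aF.
Qed.

Lemma parent_extend a : a \in S :\: core S ->
  parent (extend a) = omap s (parent a).
Proof.
move=> aF; case pa : (parent a) => [p|] /=.
  have [ra ea] := extend_leaf aF pa; have [pC _] := parent_Some pa.
  by apply/eqP; rewrite -edge_core ?extend_fringe ?sC // e_sym.
by case/setDP: aF => _ /negbTE aC; rewrite /extend aC pa.
Qed.

Lemma extend_inj : {in S &, injective extend}.
Proof.
have [si sr se] := s_aut.
move=> a b aS bS E.
have ab : r a b by rewrite (r_left (extend_r aS)) E rC extend_r.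
have [aC|aC] := boolP (a \in core S).
  have bC := core_stable ab aC.
  by move: E; rewrite !extend_core //; apply: si.
have aF : a \in S :\: core S by rewrite inE aC.
have bF := fringe_stable ab aF.
have bC : b \notin core S by case/setDP: bF.
have := parent_extend aF; rewrite E parent_extend //.
case pb : (parent b) => [q|]; case pa : (parent a) => [p|] //=; last first.
  by move: E; rewrite /extend (negbTE aC) (negbTE bC) pa pb.
have [pC eap] := parent_Some pa; have [qC ebq] := parent_Some pb.
case=> /si pq; move: E; rewrite /extend (negbTE aC) (negbTE bC) pa pb pq //.
rewrite -(rclass_eq ab); apply: transport_inj.
- exact: card_sibling.
- by rewrite !inE rxx e_sym.
- by rewrite !inE ab e_sym -(pq qC pC).
Qed.

(** An edge between the core and the fringe is recorded by [parent], which
    [extend] carries along with [s]; both ends of an edge inside the fringe have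
    no parent and are fixed. *)
Lemma extend_edge : {in S &, forall a b, e (extend a) (extend b) = e a b}.
Proof.
have [si sr se] := s_aut.
have core_fringe_edge a b : a \in core S -> b \in S :\: core S ->
    e (extend b) (extend a) = e b a.
  move=> aC bF; rewrite (extend_core aC) !edge_core ?extend_fringe ?sC //.
  rewrite parent_extend //; case pb : (parent b) => [q|] //=.
  have [qC _] := parent_Some pb.
  by apply/eqP/eqP => [[/si ->]|[->]].
have fringe_edge a b : a \in S :\: core S -> b \in S :\: core S -> parent a != None ->
    e (extend a) (extend b) = e a b.
  move=> aF bF; case pa : (parent a) => [p|//] _; rewrite (edge_fringe aF bF pa).
  by apply: (@edge_fringe _ _ (s p)); rewrite ?extend_fringe // parent_extend // pa.
move=> a b aS bS.
have [aC|aC] := boolP (a \in core S); have [bC|bC] := boolP (b \in core S).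
- by rewrite !extend_core // se.
- have bF : b \in S :\: core S by rewrite inE bC.
  by rewrite e_sym (core_fringe_edge a b aC bF) e_sym.
- have aF : a \in S :\: core S by rewrite inE aC.
  exact: core_fringe_edge.
have aF : a \in S :\: core S by rewrite inE aC.
have bF : b \in S :\: core S by rewrite inE bC.
have [pa|] := eqVneq (parent a) None; last exact: fringe_edge.
have [pb|] := eqVneq (parent b) None; last first.
  by rewrite e_sym [RHS]e_sym; apply: fringe_edge.
by rewrite /extend (negbTE aC) (negbTE bC) pa pb.
Qed.

Lemma extend_aut : local_aut S extend.
Proof. by split; [exact: extend_inj | exact: extend_r | exact: extend_edge]. Qed.

End Extend.

Lemma local_orbit_core x : x \in core S -> local_orbit S x = local_orbit (core S) x.
Proof.
move=> xC; apply/setP => y; apply/local_orbitP/local_orbitP => -[s sa <-].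
  by exists s => //; apply: local_autS sa; apply: core_sub.
by exists (extend s); [exact: extend_aut | rewrite extend_core].
Qed.

(** If the neighbour [q] of [y] is the image of [p] under [s], then the extension
    of [s] sends [x] to some leaf [z] of [q] in the class of [y]; leaves of the
    same vertex are twins, so [z] can then be exchanged with [y]. *)
Lemma local_orbit_leaf x p : x \in S :\: core S -> parent x = Some p ->
  local_orbit S x =
  [set y | r x y && (nbrs (local_orbit (core S) p) y != set0)].
Proof.
move=> xF px; have [pC exp] := parent_Some px.
have xS : x \in S by case/setDP: xF.
have pS := subsetP (core_sub S) p pC.
apply/setP => y; rewrite inE; apply/local_orbitP/andP => [[s sa <-]|[rxy]].
  have [_ sr se] := sa; rewrite sr //; split=> //.
  apply/set0Pn; exists (s p); rewrite inE se // exp andbT -local_orbit_core //.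
  by apply/local_orbitP; exists s.
have yF := fringe_stable rxy xF.
case/set0Pn => q; rewrite inE => /andP[/local_orbitP[s sa sp] eyq].
have [si sr se] := sa.
have qC : q \in core S by rewrite -sp; apply: core_stable (sr _ pC) pC.
set z := extend s x.
have zF : z \in S :\: core S by apply: extend_fringe.
have [rxz _] := extend_leaf sa xF px.
have par_z : parent z = Some q by rewrite parent_extend // px /= sp.
have par_y : parent y = Some q by apply/eqP; rewrite -edge_core.
exists (tperm z y \o extend s); last by rewrite /= tpermL.
apply: (local_aut_comp Sst); last exact: extend_aut.
apply: local_aut_twin.
- by case/setDP: zF.
- by case/setDP: yF.
- by rewrite -(r_left rxz).
move=> a aS; rewrite e_sym [RHS]e_sym.
have [aC|aC] := boolP (a \in core S).
  by rewrite !edge_core // par_z par_y.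
have aF : a \in S :\: core S by rewrite inE aC.
by rewrite (edge_fringe zF aF par_z) (edge_fringe yF aF par_y).
Qed.

(** The two edges are components of [S].  They may coincide, with [y = x] or
    [y = x'], and the involution below covers these cases as well. *)
Lemma local_aut_swap x x' y y' :
  x \in S :\: core S -> x' \in S :\: core S ->
  r x y -> r x' y' -> e x x' -> e y y' ->
  exists2 s, local_aut S s & s x = y.
Proof.
move=> xF x'F rxy rx'y' exx' eyy'.
have yF := fringe_stable rxy xF; have y'F := fringe_stable rx'y' x'F.
have inS a : a \in S :\: core S -> a \in S by case/setDP.
have nx b : b \in S -> e x b = (b == x').
  move=> bS; apply/idP/eqP => [exb|->//].
  by apply: (fringe_nbr_uniq xF) => //; apply: inS.
have nx' b : b \in S -> e x' b = (b == x).
  move=> bS; apply/idP/eqP => [exb|->]; last by rewrite e_sym.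
  by apply: (fringe_nbr_uniq x'F) => //; [exact: inS | rewrite e_sym].
have ny b : b \in S -> e y b = (b == y').
  move=> bS; apply/idP/eqP => [exb|->//].
  by apply: (fringe_nbr_uniq yF) => //; apply: inS.
have ny' b : b \in S -> e y' b = (b == y).
  move=> bS; apply/idP/eqP => [exb|->]; last by rewrite e_sym.
  by apply: (fringe_nbr_uniq y'F) => //; [exact: inS | rewrite e_sym].
have xx' : x != x' by apply: contraL exx' => /eqP <-; rewrite e_irr.
have yy' : y != y' by apply: contraL eyy' => /eqP <-; rewrite e_irr.
have y_x' : y = x' -> y' = x.
  by move=> yx'; apply/eqP; rewrite -nx' ?inS // -yx'.
have y'_x : y' = x -> y = x'.
  by move=> y'x; apply/eqP; rewrite -nx ?inS // -y'x e_sym.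
pose s a := if a == x then y else if a == x' then y' else
            if a == y then x else if a == y' then x' else a.
have sx : s x = y by rewrite /s eqxx.
have sx' : s x' = y' by rewrite /s eq_sym (negbTE xx') eqxx.
have sy : s y = x.
  by rewrite /s eqxx; case: eqVneq => // _; case: eqVneq.
have sy' : s y' = x'.
  rewrite /s; case: eqVneq => // _; case: eqVneq => // _.
  by rewrite eq_sym (negbTE yy') eqxx.
have s_id a : a != x -> a != x' -> a != y -> a != y' -> s a = a.
  by rewrite /s => /negbTE-> /negbTE-> /negbTE-> /negbTE->.
have s_cases (P : V -> Prop) : P x -> P x' -> P y -> P y' ->
    (forall a, s a = a -> P a) -> forall a, P a.
  move=> Px Px' Py Py' Pid a.
  have [->//|ax] := eqVneq a x; have [->//|ax'] := eqVneq a x'.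
  have [->//|ay] := eqVneq a y; have [->//|ay'] := eqVneq a y'.
  exact/Pid/s_id.
have sK : involutive s.
  by apply: s_cases => [||||a sa]; rewrite ?sx ?sx' ?sy ?sy' // !sa.
have s_r a : r a (s a).
  move: a; apply: s_cases => [||||a ->]; rewrite ?sx ?sx' ?sy ?sy' ?rxx // rC //.
have sS a : a \in S -> s a \in S by apply: Sst.
have s_inj := inv_inj sK.
exists s => //; split => [a b _ _|a _|]; [exact: s_inj | exact: s_r |].
(* A moved vertex has a single neighbour in S, which moves along with it. *)
have sE a b c d : {in S, forall b, e a b = (b == c)} ->
    {in S, forall b, e (s a) b = (b == d)} -> s c = d ->
    b \in S -> e (s a) (s b) = e a b.
  by move=> ea esa sc bS; rewrite ea // esa ?sS // -sc (inj_eq s_inj).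
have moved : forall a, s a != a -> {in S, forall b, e (s a) (s b) = e a b}.
  apply: s_cases => [_ b|_ b|_ b|_ b|a ->]; last by rewrite eqxx.
  - by apply: (sE _ _ x' y') => //; rewrite sx.
  - by apply: (sE _ _ x y) => //; rewrite sx'.
  - by apply: (sE _ _ y' x') => //; rewrite sy.
  - by apply: (sE _ _ y x) => //; rewrite sy'.
move=> a b aS bS; have [sa|/moved->//] := eqVneq (s a) a.
have [sb|sb] := eqVneq (s b) b; first by rewrite sa sb.
by rewrite e_sym moved // e_sym.
Qed.

(** Isolated vertices of one class are twins.  In a two-vertex component [x x'],
    counting neighbours in the class of [x'] shows that every [y] in the class
    of [x] lies in a component [y y'] with [y'] in the class of [x']. *)
Lemma local_orbit_orphan x : x \in S :\: core S -> parent x = None ->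
  local_orbit S x = rclass x.
Proof.
move=> xF px; have xS : x \in S by case/setDP: xF.
apply/setP => y; rewrite [RHS]inE; apply/local_orbitP/idP => [[s [_ sr _] <-]|rxy].
  exact: sr.
have yF := fringe_stable rxy xF; have yS : y \in S by case/setDP: yF.
have orphan a b : a \in S :\: core S -> parent a = None -> b \in S -> e a b ->
    b \in S :\: core S.
  move=> aF pa bS eab; rewrite inE bS andbT; apply/negP => bC.
  by move: eab; rewrite edge_core // pa.
have [x'0|[x']] := set_0Vmem (nbrs S x).
  have y'0 : nbrs S y = set0.
    by apply/eqP; rewrite -cards_eq0 -(proj2 S_reg x y xS rxy) x'0 cards0.
  exists (tperm x y); last by rewrite tpermL.
  apply: local_aut_twin => // a aS; rewrite e_sym [RHS]e_sym.
  by move/setP/(_ a): x'0; move/setP/(_ a): y'0; rewrite !in_set0 !inE aS /= => -> ->.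
rewrite inE => /andP[x'S exx']; have x'F := orphan x x' xF px x'S exx'.
have : nbrs (rclass x') y != set0.
  rewrite -card_gt0 -(card_fringe_nbrs (@rclass_stable x') _ xS rxy).
    by apply/card_gt0P; exists x'; rewrite !inE rxx.
  exact: rclass_sub fringe_stable x'F.
case/set0Pn => y'; rewrite !inE => /andP[rx'y' eyy'].
exact: (@local_aut_swap x x' y y').
Qed.

End Peel.

(** * Every local orbit is definable *)

(** To be instantiated with: the indicator vector lies in [M 1].  The bound in
    [definable_nbrs] makes the adjacency matrix send the indicator of [O] to a
    0-1 vector on the class of [x]. *)
Variable definable : {set V} -> Prop.
Hypothesis definable_class : forall x, definable (rclass x).
Hypothesis definable_nbrs : forall (x : V) (O : {set V}), definable O ->
  (forall y, r x y -> #|nbrs O y| <= 1) ->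
  definable [set y | r x y && (nbrs O y != set0)].

Lemma local_orbit_definable (S : {set V}) x :
  regular S -> x \in S -> definable (local_orbit S x).
Proof.
have [n leSn] := ubnP #|S|; elim: n => // n IHn in S x leSn *.
move=> Sreg xS; have Creg := core_regular Sreg.
have IH z : z \in core S -> definable (local_orbit (core S) z).
  move=> zC; apply: IHn (Creg) (zC); apply: leq_trans (leSn : #|S| <= n).
  exact/proper_card/(core_proper xS).
have [xC|xC] := boolP (x \in core S).
  by rewrite (local_orbit_core Sreg xC); apply: IH.
have xF : x \in S :\: core S by rewrite inE xC.
case px : (parent S x) => [p|]; last first.
  by rewrite (local_orbit_orphan Sreg xF px); apply: definable_class.
have [pC _] := parent_Some px.
rewrite (local_orbit_leaf Sreg xF px).
apply: definable_nbrs; first exact: IH.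
move=> y rxy; have yF := fringe_stable Sreg rxy xF.
have sub w : w \in local_orbit (core S) p -> w \in S.
  case/local_orbitP => s [_ sr _] <-; apply: (subsetP (core_sub S)).
  exact: core_stable Sreg _ _ (sr _ pC) pC.
apply/card_le1_eqP => v u /setIdP[/sub vS ev] /setIdP[/sub uS eu].
exact: (fringe_nbr_uniq yF).
Qed.

End Neighbours.

Local Open Scope ring_scope.
Import GRing.Theory Num.Theory.

(** * Diagonal matrices in a matrix algebra *)

Section Averaging.
Variables (R : realType) (V : finType) (r : rel V).
Hypothesis r_eqv : equivalence_rel r.

(** Every member [x] of the class of [z] contributes the same amount; dividing by
    the size of the class avoids a choice of representatives. *)
Lemma invariant_decomposition (f : V -> R) (z : V) :
  (forall x y, r x y -> f x = f y) ->
  f z = \sum_x f x / #|rclass r x|%:R * (r x z)%:R.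
Proof.
move=> f_inv; pose c := f z / #|rclass r z|%:R.
rewrite (eq_bigr (fun x => if x \in rclass r z then c else 0)) => [|x _].
  rewrite -big_mkcond sumr_const -[RHS]mulr_natr /c mulfVK // pnatr_eq0 -lt0n.
  by apply/card_gt0P; exists z; rewrite inE (rxx r_eqv).
rewrite inE (rC r_eqv z x); have [rxz|] := boolP (r x z); last by rewrite mulr0.
by rewrite mulr1 (rclass_eq r_eqv rxz) (f_inv _ _ rxz).
Qed.

End Averaging.

Section DiagonalEquivalence.
Variables (R : realType) (V : finType).

Definition diagf (f : V -> R) : 'M[R]_#|V| := diag_mx (\row_i f (enum_val i)).

Lemma diagfE f i j : diagf f i j = f (enum_val i) *+ (i == j).
Proof. by rewrite !mxE. Qed.

Lemma eq_diagf f g : f =1 g -> diagf f = diagf g.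
Proof. by move=> fg; apply/matrixP => i j; rewrite !diagfE fg. Qed.

Lemma diagf1 : diagf (fun=> 1) = 1%:M.
Proof. by apply/matrixP => i j; rewrite !mxE. Qed.

Lemma diagfP a f g : diagf (fun x => a * f x + g x) = a *: diagf f + diagf g.
Proof.
by apply/matrixP => i j; rewrite !(mxE, diagfE) mulrnDl mulrnAr.
Qed.

Lemma diagfM f g : diagf (fun x => f x * g x) = diagf f *m diagf g.
Proof.
apply/matrixP => i j; rewrite mul_diag_mx !mxE.
by rewrite mulrnAr.
Qed.

Lemma sum_enum_val (F : V -> R) : \sum_(i < #|V|) F (enum_val i) = \sum_x F x.
Proof.
rewrite [RHS](reindex (fun i : 'I_#|V| => enum_val i)) //.
exact/onW_bij/enum_val_bij.
Qed.

Variable M : set 'M[R]_#|V|.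
Hypothesis M_alg : matrix_subalgebra M.

Lemma alg_mul X Y : M X -> M Y -> M (X *m Y).
Proof. by case: M_alg => _ _; apply. Qed.

Lemma alg_diag_const c : M (diagf (fun=> c)).
Proof.
case: M_alg => M1 ML _.
rewrite (@eq_diagf _ (fun=> (c - 1) * 1 + 1)); last by move=> x; rewrite mulr1 subrK.
by rewrite (diagfP (c - 1) (fun=> 1) (fun=> 1)) !diagf1; apply: ML.
Qed.

Lemma alg_diag_lin a f g :
  M (diagf f) -> M (diagf g) -> M (diagf (fun x => a * f x + g x)).
Proof. by move=> Mf Mg; rewrite diagfP; case: M_alg => _ ML _; apply: ML. Qed.

Lemma alg_diag_sum (I : Type) (s : seq I) (a : I -> R) (F : I -> V -> R) :
  (forall i, M (diagf (F i))) -> M (diagf (fun x => \sum_(i <- s) a i * F i x)).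
Proof.
move=> MF; elim: s => [|i s IHs].
  rewrite (@eq_diagf _ (fun=> 0)); first exact: alg_diag_const.
  by move=> x; rewrite big_nil.
rewrite (@eq_diagf _ (fun x => a i * F i x + \sum_(j <- s) a j * F j x)).
  exact: alg_diag_lin.
by move=> x; rewrite big_cons.
Qed.

Lemma alg_diag_prod (I : Type) (s : seq I) (F : I -> V -> R) :
  (forall i, M (diagf (F i))) -> M (diagf (fun x => \prod_(i <- s) F i x)).
Proof.
move=> MF; elim: s => [|i s IHs].
  rewrite (@eq_diagf _ (fun=> 1)); first exact: alg_diag_const.
  by move=> x; rewrite big_nil.
rewrite (@eq_diagf _ (fun x => F i x * \prod_(j <- s) F j x)).
  by rewrite diagfM; apply: alg_mul.
by move=> x; rewrite big_cons.
Qed.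

Definition diag_equiv (x y : V) : bool :=
  `[< forall f : V -> R, M (diagf f) -> f x = f y >].

Lemma diag_equivP x y :
  reflect (forall f : V -> R, M (diagf f) -> f x = f y) (diag_equiv x y).
Proof. exact: asboolP. Qed.

Lemma diag_equiv_eqv : equivalence_rel diag_equiv.
Proof.
move=> x y z; split; first exact/diag_equivP.
move=> /diag_equivP xy; apply/diag_equivP/diag_equivP => h f Mf.
  by rewrite -(xy f Mf); apply: h.
by rewrite (xy f Mf); apply: h.
Qed.

Lemma alg_separate x y : exists g : V -> R,
  [/\ M (diagf g), g x = 1 & ~~ diag_equiv x y -> g y = 0].
Proof.
have [_|/asboolPn/existsNP[f /not_implyP[Mf /eqP fxy]]] := boolP (diag_equiv x y).
  by exists (fun=> 1); split=> //; apply: alg_diag_const.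
have d0 : f x - f y != 0 by rewrite subr_eq0.
exists (fun z => (f x - f y)^-1 * f z + - ((f x - f y)^-1 * f y)); split.
- exact: alg_diag_lin (alg_diag_const _).
- by rewrite -mulrBr mulVf.
- by rewrite subrr.
Qed.

(** Lagrange interpolation: multiply, over all [y], functions that are 1 at [x]
    and vanish at [y] whenever [y] is not equivalent to [x]. *)
Lemma alg_diag_class x : M (diagf (fun y => (diag_equiv x y)%:R)).
Proof.
have [G GP] := choice (alg_separate x).
rewrite (@eq_diagf _ (fun z => \prod_y G y z)).
  by apply: alg_diag_prod => y; case: (GP y).
move=> z; have [/diag_equivP xz|xz] := boolP (diag_equiv x z).
  by rewrite big1 // => y _; have [MG <- _] := GP y; rewrite (xz _ MG).
by have [_ _ Gz] := GP z; rewrite (bigD1 z) //= Gz ?mul0r.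
Qed.

Lemma alg_diag_invariant f :
  (forall x y, diag_equiv x y -> f x = f y) -> M (diagf f).
Proof.
move=> f_inv.
rewrite (eq_diagf (fun z => invariant_decomposition diag_equiv_eqv z f_inv)).
by apply: alg_diag_sum => x; apply: alg_diag_class.
Qed.

Lemma alg_diag_stable (B : {set V}) :
  stable diag_equiv B -> M (diagf (fun x => (x \in B)%:R)).
Proof.
move=> sB; apply: alg_diag_invariant => x y xy.
by rewrite (stableE diag_equiv_eqv sB xy).
Qed.

Variable e : rel V.
Hypothesis e_sym : symmetric e.
Hypothesis M_adj : M (adjacency_mx R e).

Lemma adjacency_sum (B : {set V}) (x : V) :
  \sum_y (e x y)%:R * (y \in B)%:R = #|nbrs e B x|%:R :> R.
Proof.
rewrite -sum1_card natr_sum big_mkcond /=.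
rewrite [RHS]big_mkcond; apply: eq_bigr => y _; rewrite inE.
by case: (e x y); case: (y \in B); rewrite ?mulr1 ?mulr0 ?mul0r.
Qed.

(** With P_T and P_K the projections to the coordinates in [T] and [K], the matrix
    P_T A P_K A P_T has as its (x, y) entry the number of common neighbours of
    [x] and [y] in [K].  The hypothesis makes it diagonal. *)
Lemma diag_equiv_card_nbrs (T K : {set V}) :
  stable diag_equiv T -> stable diag_equiv K ->
  (forall x y z, x \in T -> y \in T -> z \in K -> e x z -> e y z -> x = y) ->
  forall x y, x \in T -> diag_equiv x y -> #|nbrs e K x| = #|nbrs e K y|.
Proof.
move=> sT sK TK x y xT xy.
pose cnt z : R := (z \in T)%:R * #|nbrs e K z|%:R.
suff Mcnt : M (diagf cnt).
  have := diag_equivP _ _ xy cnt Mcnt.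
  rewrite /cnt -(stableE diag_equiv_eqv sT xy) xT !mul1r => /eqP.
  by rewrite eqr_nat => /eqP.
suff -> : diagf cnt = diagf (fun z => (z \in T)%:R) *m
    (adjacency_mx R e *m (diagf (fun z => (z \in K)%:R) *m
    (adjacency_mx R e *m diagf (fun z => (z \in T)%:R)))).
  by do ?apply: alg_mul => //; apply: alg_diag_stable.
apply/matrixP => i j; rewrite mul_diag_mx [RHS]mxE diagfE mxE [X in _ * X]mxE.
pose F z : R := (e (enum_val i) z)%:R * ((z \in K)%:R *
   ((e z (enum_val j))%:R * (enum_val j \in T)%:R)).
rewrite (eq_bigr (fun k => F (enum_val k))) => [|k _]; last first.
  by rewrite mul_diag_mx mul_mx_diag !mxE.
rewrite sum_enum_val /F.
have [<-|ij] := eqVneq i j.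
  rewrite mulr1n /cnt; have [iT|] := boolP (_ \in T); last by rewrite !mul0r.
  rewrite -adjacency_sum; congr (_ * _); apply: eq_bigr => z _.
  by rewrite mulr1 (e_sym z); case: (e _ z); rewrite ?mulr1 ?mul0r.
rewrite mulr0n; have [iT|] := boolP (enum_val i \in T); last by rewrite mul0r.
have [jT|] := boolP (enum_val j \in T); last first.
  by rewrite big1 ?mulr0 // => z _; rewrite !mulr0.
rewrite big1 ?mulr0 // => z _.
have [zK|] := boolP (z \in K); last by rewrite mul0r mulr0.
have [iz|] := boolP (e _ z); last by rewrite mul0r.
have [zj|] := boolP (e z _); last by rewrite mul0r !mulr0.
rewrite e_sym in zj; have /enum_val_inj E := TK _ _ _ iT jT zK iz zj.
by rewrite E eqxx in ij.
Qed.

End DiagonalEquivalence.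

(** * The graph algebra of a forest *)

Section GraphAlgebra.
Variables (R : realType) (V : finType) (e : rel V).
Notation M := (graph_algebra R e).

Lemma graph_algebra_subalgebra : matrix_subalgebra M.
Proof.
split.
- by move=> S [[]].
- move=> a X Y MX MY S SP; have [[_ SL _] _] := SP.
  by apply: SL; [exact: MX | exact: MY].
- move=> X Y MX MY S SP; have [[_ _ SM] _] := SP.
  by apply: SM; [exact: MX | exact: MY].
Qed.

Lemma graph_algebra_adjacency : M (adjacency_mx R e).
Proof. by move=> S [_]; apply; left; right. Qed.

Lemma graph_algebra_degree : M (degree_mx R e).
Proof. by move=> S [_]; apply; right. Qed.

Lemma degree_aut (s : {perm V}) x : s \in graph_aut e -> degree e (s x) = degree e x.
Proof.
rewrite inE => /forallP sP; have eE a b : e (s a) (s b) = e a b.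
  exact/eqP/(forallP (sP a)).
rewrite /degree -[RHS](card_imset _ (@perm_inj _ s)).
apply: eq_card => y; rewrite inE; apply/idP/imsetP => [exy|[z]].
  by exists (s^-1%g y); rewrite ?permKV // inE -eE permKV.
by rewrite inE => exz ->; rewrite eE.
Qed.

(** The matrices that commute with the permutation matrix of [s] form an algebra
    containing the three generators. *)
Lemma graph_algebra_aut (s : {perm V}) X : s \in graph_aut e -> M X ->
  forall x y, X (enum_rank (s x)) (enum_rank (s y)) = X (enum_rank x) (enum_rank y).
Proof.
move=> sA; pose S := [set Y : 'M[R]_#|V| | forall x y,
  Y (enum_rank (s x)) (enum_rank (s y)) = Y (enum_rank x) (enum_rank y)]%classic.
have rank_s x y : (enum_rank (s x) == enum_rank (s y)) = (enum_rank x == enum_rank y).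
  by rewrite !(inj_eq enum_rank_inj) (inj_eq perm_inj).
move=> MX; change (S X); apply: MX; split; first split.
- by move=> x y; rewrite !mxE rank_s.
- by move=> a Y Z SY SZ x y; rewrite !mxE SY SZ.
- move=> Y Z SY SZ x y; rewrite !mxE.
  pose F u v z := Y (enum_rank u) (enum_rank z) * Z (enum_rank z) (enum_rank v).
  have sumF u v : \sum_(k < #|V|) Y (enum_rank u) k * Z k (enum_rank v) = \sum_z F u v z.
    rewrite -[RHS]sum_enum_val; apply: eq_bigr => k _; by rewrite /F enum_valK.
  rewrite !sumF (reindex_inj (@perm_inj _ s)) /=.
  by apply: eq_bigr => z _; rewrite /F SY SZ.
move=> Y [[->|->]|->] x y; rewrite !mxE ?rank_s //.
  rewrite !enum_rankK; congr (nat_of_bool _)%:R.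
  by move: sA; rewrite inE => /forallP/(_ x)/forallP/(_ y)/eqP.
by rewrite !enum_rankK degree_aut.
Qed.

Lemma ones_sub (v : 'cV[R]_#|V|) :
  graph_algebra_ones R e v -> v \in orbit_module R e.
Proof.
case=> X MX <-; pose f x := (X *m ones R V) (enum_rank x) 0.
pose r x y := y \in orbit 'P%act (graph_aut e) x.
have r_eqv : equivalence_rel r.
  move=> x y z; split; first exact: orbit_refl.
  by rewrite /r => /orbit_eqP->.
have f_inv x y : r x y -> f x = f y.
  case/orbitP => s sA <-; rewrite /f !mxE.
  have E u : \sum_(k < #|V|) X (enum_rank u) k * ones R V k 0 =
      \sum_z X (enum_rank u) (enum_rank z).
    by rewrite -[RHS]sum_enum_val; apply: eq_bigr => k _; rewrite enum_valK mxE mulr1.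
  rewrite !E [RHS](reindex_inj (@perm_inj _ s)) /=.
  by apply: eq_bigr => z _; rewrite [LHS](esym (graph_algebra_aut sA MX x z)).
have -> : X *m ones R V =
    \sum_x (f x / #|rclass r x|%:R) *: indicator R (orbit 'P%act (graph_aut e) x).
  apply/colP => i; rewrite summxE -[i]enum_valK.
  rewrite -/(f (enum_val i)) (invariant_decomposition r_eqv _ f_inv).
  by apply: eq_bigr => x _; rewrite !mxE enum_rankK.
apply: memv_suml => x _; apply/memvZ/memv_span.
by apply/image_f/imset_f.
Qed.

Lemma graph_algebra_onesP a u v :
  graph_algebra_ones R e u -> graph_algebra_ones R e v ->
  graph_algebra_ones R e (a *: u + v).
Proof.
have [_ ML _] := graph_algebra_subalgebra.
case=> X MX <- [Y MY <-]; exists (a *: X + Y); first exact: ML.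
by rewrite mulmxDl scalemxAl.
Qed.

Lemma graph_algebra_ones0 : graph_algebra_ones R e 0.
Proof.
have [M1 ML _] := graph_algebra_subalgebra.
exists (-1 *: 1%:M + 1%:M); first exact: ML.
by rewrite scaleN1r addNr mul0mx.
Qed.

Lemma sub_ones :
  (forall x, graph_algebra_ones R e (indicator R (orbit 'P%act (graph_aut e) x))) ->
  forall v, v \in orbit_module R e -> graph_algebra_ones R e v.
Proof.
move=> orb v; rewrite /orbit_module => vU.
rewrite (coord_span (X := in_tuple _) vU).
apply: (big_ind (graph_algebra_ones R e)).
- exact: graph_algebra_ones0.
- by move=> u w Wu Ww; rewrite -[u]scale1r; apply: graph_algebra_onesP.
move=> i _; rewrite -[_ *: _]addr0; apply: graph_algebra_onesP graph_algebra_ones0.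
have /imageP[B /imsetP[x _ ->] ->] := mem_nth 0 (ltn_ord i).
exact: orb.
Qed.

Hypothesis e_forest : forest e.
Let e_sym : symmetric e. Proof. by case: e_forest => -[]. Qed.
Let e_irr : irreflexive e. Proof. by case: e_forest => -[]. Qed.
Let e_acyc : acyclic e. Proof. by case: e_forest. Qed.

Notation r := (diag_equiv M).
Let r_eqv := diag_equiv_eqv M.

(** Automorphisms preserve [r], as all matrices of [M] are invariant under them;
    hence they are the local automorphisms of the whole vertex set. *)
Lemma orbit_ones x : graph_algebra_ones R e (indicator R (orbit 'P%act (graph_aut e) x)).
Proof.
have Malg := graph_algebra_subalgebra.
have reg : regular e r [set: V].
  split; first by move=> ? ? _; rewrite !inE.
  move=> u v _ /diag_equivP/(_ (fun u => (degree e u)%:R) graph_algebra_degree)/eqP.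
  rewrite eqr_nat => /eqP; rewrite /degree.
  by congr (_ = _); apply: eq_card => w; rewrite !inE.
have -> : orbit 'P%act (graph_aut e) x = local_orbit e r [set: V] x.
  apply/setP => y; apply/orbitP/local_orbitP => [[s sA <-]|[s [si sr se] <-]].
    exists s => //; split=> [|a _|a b _ _].
    - by move=> a b _ _; apply: perm_inj.
    - apply/diag_equivP => f Mf.
      have := graph_algebra_aut sA Mf a a.
      by rewrite !diagfE !eqxx !enum_rankK.
    - by move: sA; rewrite inE => /forallP/(_ a)/forallP/(_ b)/eqP.
  have s_inj : injective s by move=> a b; apply: si; rewrite inE.
  exists (perm s_inj); last by rewrite /= apermE permE.
  rewrite inE; apply/forallP => a; apply/forallP => b.
  by rewrite !permE se // inE.
apply: (@local_orbit_definable _ _ e_sym e_irr e_acyc r r_eqv _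
   (fun B => graph_algebra_ones R e (indicator R B))); rewrite ?inE //.
- exact: (diag_equiv_card_nbrs Malg e_sym (@graph_algebra_adjacency)).
- move=> u; exists (diagf (fun y => (r u y)%:R)); first exact: alg_diag_class.
  by apply/colP => i; rewrite mul_diag_mx !mxE inE mulr1.
move=> u O [X MX XO] uniq_nbr.
exists (diagf (fun y => (r u y)%:R) *m (adjacency_mx R e *m X)).
  have MA : M (adjacency_mx R e) := @graph_algebra_adjacency.
  exact: (alg_mul Malg (alg_diag_class Malg u) (alg_mul Malg MA MX)).
rewrite -!mulmxA XO; apply/colP => i; rewrite mul_diag_mx !mxE.
rewrite (eq_bigr (fun k => (fun z => (e (enum_val i) z)%:R * (z \in O)%:R) (enum_val k)));
  last by move=> k _; rewrite !mxE.
rewrite (sum_enum_val (fun z => (e (enum_val i) z)%:R * (z \in O)%:R)) adjacency_sum.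
rewrite inE; have [/uniq_nbr|] := boolP (r u _); last by rewrite mul0r.
by rewrite mul1r -card_gt0; case: #|_| => [|[]].
Qed.

Lemma graph_algebra_ones_forest :
  graph_algebra_ones R e = [set` orbit_module R e]%classic.
Proof.
apply/seteqP; split=> v /=; first exact: ones_sub.
exact/sub_ones/orbit_ones.
Qed.

End GraphAlgebra.

Theorem theorem3p3 (R : realType) :
  (forall (V : finType) (e : rel V),
     forest e ->
     graph_algebra_ones R e = [set` orbit_module R e]%classic) /\
  (forall (V : finType) (e : rel V),
     tree e ->
     graph_algebra_ones R e = [set` orbit_module R e]%classic).
Proof.
by split=> V e; [|case=> + _]; apply: graph_algebra_ones_forest.
Qed.
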